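(* Let $\mathbf{X}_1,\mathbf{X}_2,\mathbf{X}_3$ be (possibly different) BNM schemes, and let $\mathbb{SS}$, $\mathbb{TT}$, $\mathbb{ST}$ be the sets of inferences valid according to the standard $\mathbf{ss}$ over $\mathbf{X}_1$, the standard $\mathbf{tt}$ over $\mathbf{X}_2$, and the standard $\mathbf{st}$ over $\mathbf{X}_3$, respectively. Then the set $$\{\mathbb{ST},\ \mathbb{SS},\ \mathbb{TT},\ \mathbb{SS}\cap\mathbb{TT}\},$$ partially ordered by inclusion $\subseteq$, is a lattice, with infimum $\inf\{\mathbb{X},\mathbb{Y}\}=\mathbb{X}\cap\mathbb{Y}$ and supremum $\sup\{\mathbb{X},\mathbb{Y}\}=T(\mathbb{X}\cup\mathbb{Y})$ for all elements $\mathbb{X},\mathbb{Y}$ of the set, where $T$ denotes transitive closure.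
   Context: Formulas: the propositional language $\mathcal{L}$ is built from a denumerably infinite set $\mathit{Var}$ of propositional variables using only $\neg$, $\lor$, $\wedge$ (no propositional constants). An inference $\Gamma\Rightarrow\phi$ is an ordered pair $\langle\Gamma,\phi\rangle$ with $\Gamma\subseteq\mathcal{L}$ finite (possibly empty) and $\phi\in\mathcal{L}$. Schemes: a (three-valued) scheme $\mathbf{X}$ is a triple $(f_\neg,f_\wedge,f_\vee)$ of operations on $\{0,\frac12,1\}$ (unary, binary, binary). It is Boolean normal if each operation, restricted to arguments in $\{0,1\}$, agrees with the corresponding operation of the two-element Boolean algebra. Let $\leq_{\rm I}$ be the partial order on $\{0,\frac12,1\}$ whose strict part is $\frac12<_{\rm I}0$ and $\frac12<_{\rm I}1$. The scheme is monotonic if each of its operations is monotone from the componentwise order induced by $\leq_{\rm I}$ to $\leq_{\rm I}$. A BNM scheme is a Boolean normal monotonic scheme. An $\mathbf{X}$-valuation is a map $v:\mathcal{L}\to\{0,\frac12,1\}$ such that $v(\neg\phi)=f_\neg(v(\phi))$, $v(\phi\wedge\psi)=f_\wedge(v(\phi),v(\psi))$, $v(\phi\vee\psi)=f_\vee(v(\phi),v(\psi))$. Standards: let $\mathbf{s}=\{1\}$ and $\mathbf{t}=\{1,\frac12\}$. For $\mathbf{x},\mathbf{y}\in\{\mathbf{s},\mathbf{t}\}$, a valuation $v$ satisfies $\Gamma\Rightarrow\phi$ according to $\mathbf{xy}$ if: whenever $v(\gamma)\in\mathbf{x}$ for all $\gamma\in\Gamma$, then $v(\phi)\in\mathbf{y}$.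 An inference is valid according to $\mathbf{xy}$ over $\mathbf{X}$ if it is satisfied according to $\mathbf{xy}$ by every $\mathbf{X}$-valuation. Transitive closure: for a set of inferences $\mathbb{L}$, $T(\mathbb{L})$ is the least set $\mathbb{L}'\supseteq\mathbb{L}$ of inferences such that, for all $\Gamma,\phi$: if there is a (finite) $\Delta\neq\emptyset$ with $\Delta\Rightarrow\phi\in\mathbb{L}'$ and $\Gamma\Rightarrow\delta\in\mathbb{L}'$ for all $\delta\in\Delta$, then $\Gamma\Rightarrow\phi\in\mathbb{L}'$. *)

(* Defs.v *)
From HB Require Import structures.
From mathcomp Require Import all_boot.
From mathcomp Require Import finmap.
From mathcomp Require Import boolp classical_sets.

Set Implicit Arguments.
Unset Strict Implicit.
Unset Printing Implicit Defensive.

Local Open Scope classical_set_scope.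

Inductive form : Type :=
| Var of nat
| Neg of form
| And of form & form
| Or of form & form.

(* The encoding only serves to obtain the choiceType structure on formulas
   required by {fset form}. *)
Fixpoint form_encode (p : form) : GenTree.tree nat :=
  match p with
  | Var n => GenTree.Leaf n
  | Neg q => GenTree.Node 0 [:: form_encode q]
  | And q r => GenTree.Node 1 [:: form_encode q; form_encode r]
  | Or q r => GenTree.Node 2 [:: form_encode q; form_encode r]
  end.

Fixpoint form_decode (t : GenTree.tree nat) : option form :=
  match t with
  | GenTree.Leaf n => Some (Var n)
  | GenTree.Node 0 [:: t1] => omap Neg (form_decode t1)
  | GenTree.Node 1 [:: t1; t2] =>
      if (form_decode t1, form_decode t2) is (Some q, Some r)
      then Some (And q r) else None
  | GenTree.Node 2 [:: t1; t2] =>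
      if (form_decode t1, form_decode t2) is (Some q, Some r)
      then Some (Or q r) else None
  | _ => None
  end.

Lemma form_encodeK : pcancel form_encode form_decode.
Proof. by elim=> //= [q -> | q -> r -> | q -> r ->]. Qed.

HB.instance Definition _ := Countable.copy form (pcan_type form_encodeK).

Definition inference : Type := ({fset form} * form)%type.

Inductive tval : Type := V0 | Vhalf | V1.

Definition tval_of_bool (b : bool) : tval := if b then V1 else V0.

Record scheme : Type := Scheme {
  f_neg : tval -> tval;
  f_and : tval -> tval -> tval;
  f_or : tval -> tval -> tval
}.

Definition boolean_normal (X : scheme) : Prop :=
  [/\ forall b, f_neg X (tval_of_bool b) = tval_of_bool (~~ b),
      forall b c, f_and X (tval_of_bool b) (tval_of_bool c)
                  = tval_of_bool (b && c)
    & forall b c, f_or X (tval_of_bool b) (tval_of_bool c)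
                  = tval_of_bool (b || c)].

Definition leI (x y : tval) : Prop := x = Vhalf \/ x = y.

Definition monotonic (X : scheme) : Prop :=
  [/\ forall x y, leI x y -> leI (f_neg X x) (f_neg X y),
      forall x1 x2 y1 y2, leI x1 y1 -> leI x2 y2 ->
        leI (f_and X x1 x2) (f_and X y1 y2)
    & forall x1 x2 y1 y2, leI x1 y1 -> leI x2 y2 ->
        leI (f_or X x1 x2) (f_or X y1 y2)].

Definition BNM (X : scheme) : Prop := boolean_normal X /\ monotonic X.

Definition valuation (X : scheme) (v : form -> tval) : Prop :=
  [/\ forall p, v (Neg p) = f_neg X (v p),
      forall p q, v (And p q) = f_and X (v p) (v q)
    & forall p q, v (Or p q) = f_or X (v p) (v q)].

Definition strict : set tval := [set V1].
Definition tolerant : set tval := [set V1; Vhalf].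

Definition satisfies (x y : set tval) (v : form -> tval) (i : inference) : Prop :=
  (forall g, g \in i.1 -> x (v g)) -> y (v i.2).

Definition valid (x y : set tval) (X : scheme) : set inference :=
  [set i | forall v, valuation X v -> satisfies x y v i].

Definition transitive_closed (L : set inference) : Prop :=
  forall (G : {fset form}) (p : form),
    (exists D : {fset form},
      [/\ D <> fset0, L (D, p) & forall d, d \in D -> L (G, d)]) ->
    L (G, p).

Definition T (L : set inference) : set inference :=
  smallest transitive_closed L.

(* Closedness is preserved by intersections, so T L is itself closed and is
   the least closed superset of L. *)
Lemma transitive_closed_T (L : set inference) : transitive_closed (T L).
Proof.
move=> G p [D [D0 LD LG]] M [Mt LM].
apply: (Mt); exists D; split; [exact: D0 | exact: (LD M (conj Mt LM)) |].
by move=> d dD; exact: (LG d dD M (conj Mt LM)).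
Qed.

Section Lattice.
Context {U : Type}.
Implicit Types (F : set U) (le : U -> U -> Prop).

Definition is_inf F le (x y z : U) : Prop :=
  [/\ F z, le z x, le z y &
      forall w, F w -> le w x -> le w y -> le w z].

Definition is_sup F le (x y z : U) : Prop :=
  [/\ F z, le x z, le y z &
      forall w, F w -> le x w -> le y w -> le z w].

Definition is_partial_order F le : Prop :=
  [/\ forall x, F x -> le x x,
      forall x y, F x -> F y -> le x y -> le y x -> x = y
    & forall x y z, F x -> F y -> F z -> le x y -> le y z -> le x z].

Definition is_lattice F le : Prop :=
  is_partial_order F le /\
  forall x y, F x -> F y ->
    (exists z, is_inf F le x y z) /\ (exists z, is_sup F le x y z).

End Lattice.

(* Main.v *)
Require Import Defs.
From mathcomp Require Import all_boot.
From mathcomp Require Import finmap.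
From mathcomp Require Import boolp classical_sets.

Local Open Scope classical_set_scope.

(** Everything is compared with classical validity.  Over any BNM scheme, [ST]
    is exactly classical logic: two-valued valuations are valuations of the
    scheme by normality, and conversely every three-valued valuation can be
    sharpened, by choosing bits for the undetermined variables, to a two-valued
    one which by monotonicity agrees with it wherever it is determined
    ([leI_beval]), so that a counterexample to [ST] becomes a classical one.
    Normality alone also puts [SS] and [TT] inside classical logic.  The four
    sets therefore form a diamond, with [ST] on top and the meet of [SS] and
    [TT] at the bottom, whence the infima.

    For the suprema, all four sets are transitively closed, so the closure of
    the union of two of them lies below every upper bound in the family, and
    it only has to be shown that this closure belongs to the family.  The one
    pair of possibly incomparable sets is [SS], [TT], and there the closure is
    all of classical logic: excluded middle [Or p (Neg p)] serves as a cut
    formula.  It is tolerantly valid because it is a tautology; as a strictly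
    true premise it forces [p] to be determined, which upgrades a classical
    consequence [p] to a strict one ([classical_sub_T]). *)

Fixpoint beval (s : nat -> bool) (p : form) : bool :=
  match p with
  | Var n => s n
  | Neg q => ~~ beval s q
  | And q r => beval s q && beval s r
  | Or q r => beval s q || beval s r
  end.

Definition classical : set inference :=
  [set i | forall s, {in i.1, forall g, beval s g} -> beval s i.2].

Lemma leI_distinct_bool_half x b c :
  leI x (tval_of_bool b) -> leI x (tval_of_bool c) -> b <> c -> x = Vhalf.
Proof. by case=> [//|->] []; case: b c => [] [] //=. Qed.

Lemma valuation_beval X s :
  boolean_normal X -> valuation X (tval_of_bool \o beval s).
Proof. by case=> hn ha ho; split=> *; rewrite /= ?hn ?ha ?ho. Qed.

Lemma valid_sub_classical x y X :
  boolean_normal X -> x V1 -> ~ y V0 -> valid x y X `<=` classical.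
Proof.
move=> hX xV1 yV0 i hi s hs.
have := hi _ (valuation_beval X s hX); rewrite /satisfies /=.
case: (beval s i.2) => //= h; case: yV0; apply: h => g /hs.
by case: (beval s g).
Qed.

(** The value [false] for undetermined variables is an arbitrary choice. *)
Definition sharpening (v : form -> Defs.tval) (n : nat) : bool :=
  if v (Var n) is V1 then true else false.

(** The refinement holds at variables by construction; normality and
    monotonicity of the operations carry it up to all formulas. *)
Lemma leI_beval X v p :
  BNM X -> valuation X v -> leI (v p) (tval_of_bool (beval (sharpening v) p)).
Proof.
move=> [[bn ba bo] [mn ma mo]] [vn va vo].
elim: p => [n|q IH|q IHq r IHr|q IHq r IHr] /=.
- by rewrite /sharpening; case: (v (Var n)); [right|left|right].
- by rewrite vn -bn; apply: mn.
- by rewrite va -ba; apply: ma.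
- by rewrite vo -bo; apply: mo.
Qed.

Lemma beval_of_strict X v p :
  BNM X -> valuation X v -> v p = V1 -> beval (sharpening v) p.
Proof.
move=> hX hv e; have := leI_beval X v p hX hv; rewrite e.
by case: (beval _ p) => // -[].
Qed.

(** Strictly true premises stay true under sharpening, so the conclusion is
    classically true there; its original value lies below [V1] in the
    information order, which is precisely tolerant truth. *)
Lemma classical_sub_ST X : BNM X -> classical `<=` valid strict tolerant X.
Proof.
move=> hX i hi v hv hs.
have := leI_beval X v i.2 hX hv.
rewrite hi; last by move=> g /hs; exact: (beval_of_strict X v _ hX hv).
by case=> ->; [right|left].
Qed.

Lemma valid_ST_classical X : BNM X -> valid strict tolerant X = classical.
Proof.
move=> hX; apply/seteqP; split; last exact: classical_sub_ST.
by apply: valid_sub_classical; [case: hX | | case].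
Qed.

Lemma valid_SS_sub_classical X : BNM X -> valid strict strict X `<=` classical.
Proof. by move=> hX; apply: valid_sub_classical; [case: hX| |]. Qed.

Lemma valid_TT_sub_classical X :
  BNM X -> valid tolerant tolerant X `<=` classical.
Proof. by move=> hX; apply: valid_sub_classical; [case: hX|left|case]. Qed.

Lemma transitive_closed_valid x X : transitive_closed (valid x x X).
Proof.
move=> G p [D [_ hp hG]] v hv hs.
by apply: (hp v hv) => d dD; exact: hG dD v hv hs.
Qed.

Lemma transitive_closed_classical : transitive_closed classical.
Proof.
move=> G p [D [_ hp hG]] s hs.
by apply: (hp s) => d dD; exact: hG dD s hs.
Qed.

Lemma transitive_closedI L M :
  transitive_closed L -> transitive_closed M -> transitive_closed (L `&` M).
Proof.
move=> hL hM G p [D [D0 [Lp Mp] hG]].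
by split; [apply: hL | apply: hM]; exists D; split=> // d /hG[].
Qed.

Lemma T_sub_closed L M : transitive_closed M -> L `<=` M -> T L `<=` M.
Proof. by move=> hM LM i; apply. Qed.

Lemma sub_T L : L `<=` T L.
Proof. by move=> i Li M [_]; apply. Qed.

Lemma T_id L : transitive_closed L -> T L = L.
Proof. by move=> hL; apply/seteqP; split; [exact: T_sub_closed|exact: sub_T]. Qed.

(** Replacing the undetermined arguments of an operation by bits in two ways
    gives both classical outputs; by monotonicity the original output lies
    below both, hence is undetermined. *)
Lemma excluded_middle_half X v p :
  BNM X -> valuation X v -> v p = Vhalf -> v (Or p (Neg p)) = Vhalf.
Proof.
move=> [[bn _ bo] [mn _ mo]] [vn _ vo] e; rewrite vo vn e.
have half_le x : leI Vhalf x by left.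
have -> : f_neg X Vhalf = Vhalf.
  by apply: (leI_distinct_bool_half _ (~~ true) (~~ false)) => //; rewrite -bn; apply: mn.
by apply: (leI_distinct_bool_half _ (true || true) (false || false)) => //;
  rewrite -bo; apply: mo.
Qed.

Lemma excluded_middle_TT X G p :
  BNM X -> valid tolerant tolerant X (G, Or p (Neg p)).
Proof.
move=> hX v hv _ /=; have := leI_beval X v (Or p (Neg p)) hX hv.
by rewrite /= orbN; case=> ->; [right|left].
Qed.

(** Strict truth of excluded middle for [p] makes [p] determined, so the value
    of [p] is its classical value under the sharpening, which is true. *)
Lemma excluded_middle_SS X G p : BNM X -> classical (G, p) ->
  valid strict strict X ((Or p (Neg p) |` G)%fset, p).
Proof.
move=> hX hp v hv hs /=.
have em : v (Or p (Neg p)) = V1 by apply: hs; rewrite /= fset1U1.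
have := leI_beval X v p hX hv; rewrite hp => [|g gG].
  by case=> // /(excluded_middle_half X v p hX hv); rewrite em.
by apply: (beval_of_strict X v _ hX hv); apply: hs; rewrite /= fset1Ur.
Qed.

(** The cut is on [G] together with excluded middle for the conclusion; the
    presence of the latter also ensures that the set of cut formulas is
    nonempty when [G] is empty. *)
Lemma classical_sub_T X Y : BNM X -> BNM Y ->
  classical `<=` T (valid strict strict X `|` valid tolerant tolerant Y).
Proof.
move=> hX hY [G p] hp; apply: transitive_closed_T.
exists (Or p (Neg p) |` G)%fset; split.
- by move=> /fsetP /(_ (Or p (Neg p))); rewrite fset1U1 in_fset0.
- by apply: sub_T; left; exact: excluded_middle_SS.
- move=> d; rewrite in_fset1U => /orP[/eqP->|dG]; apply: sub_T.
    by right; exact: excluded_middle_TT.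
  by left=> v hv hs; exact: hs.
Qed.

Lemma T_SS_TT X Y : BNM X -> BNM Y ->
  T (valid strict strict X `|` valid tolerant tolerant Y) = classical.
Proof.
move=> hX hY; apply/seteqP; split; last exact: classical_sub_T.
apply: T_sub_closed; first exact: transitive_closed_classical.
by rewrite subUset; split;
  [exact: valid_SS_sub_classical|exact: valid_TT_sub_classical].
Qed.

Section Diamond.
Context {U : Type}.

Lemma is_inf_setI (F : set (set U)) X Y :
  F (X `&` Y) -> is_inf F subset X Y (X `&` Y).
Proof.
by move=> FI; split=> // W _ WX WY; rewrite subsetI.
Qed.

Lemma is_partial_order_subset (F : set (set U)) : is_partial_order F subset.
Proof.
split=> [X _ //|X Y _ _ XY YX|X Y Z _ _ _]; last exact: subset_trans.
exact/seteqP.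
Qed.

Lemma diamond_cases (S A B X Y : set U) : A `<=` S -> B `<=` S ->
  let F := [set S; A; B; A `&` B] in F X -> F Y ->
  [\/ X `<=` Y, Y `<=` X, X = A /\ Y = B | X = B /\ Y = A].
Proof.
move=> AS BS F.
have IS : A `&` B `<=` S by move=> x [/AS].
have IA : A `&` B `<=` A by exact: subIsetl.
have IB : A `&` B `<=` B by exact: subIsetr.
move=> [[[|]|]|] -> [[[|]|]|] ->;
  by [constructor 1|constructor 2|constructor 3|constructor 4].
Qed.

End Diamond.

Lemma is_sup_T (F : set (set inference)) X Y :
  (forall W, F W -> transitive_closed W) ->
  F (T (X `|` Y)) -> is_sup F subset X Y (T (X `|` Y)).
Proof.
move=> Fcl FT; split=> // [i Xi|i Yi|W FW XW YW].
- by apply: sub_T; left.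
- by apply: sub_T; right.
- by apply: T_sub_closed; [exact: Fcl | rewrite subUset].
Qed.

Theorem corollary6p5 (X1 X2 X3 : scheme)
    (hX1 : BNM X1) (hX2 : BNM X2) (hX3 : BNM X3) :
  let SS := valid strict strict X1 in
  let TT := valid tolerant tolerant X2 in
  let ST := valid strict tolerant X3 in
  let F : set (set inference) := [set ST; SS; TT; SS `&` TT] in
  is_lattice F subset /\
  (forall X Y : set inference, F X -> F Y ->
     is_inf F subset X Y (X `&` Y) /\
     is_sup F subset X Y (T (X `|` Y))).
Proof.
move=> SS TT ST F.
have eST : ST = classical by exact: valid_ST_classical.
have SS_ST : SS `<=` ST by rewrite eST; exact: valid_SS_sub_classical.
have TT_ST : TT `<=` ST by rewrite eST; exact: valid_TT_sub_classical.
have Fcl W : F W -> transitive_closed W.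
  move=> [[[|]|]|] ->.
  - by rewrite eST; exact: transitive_closed_classical.
  - exact: transitive_closed_valid.
  - exact: transitive_closed_valid.
  - by apply: transitive_closedI; exact: transitive_closed_valid.
have bounds X Y : F X -> F Y ->
    is_inf F subset X Y (X `&` Y) /\ is_sup F subset X Y (T (X `|` Y)).
  move=> FX FY.
  suff [FI FT] : F (X `&` Y) /\ F (T (X `|` Y)).
    by split; [exact: is_inf_setI | exact: is_sup_T].
  have FST : F (T (SS `|` TT)) by rewrite T_SS_TT // -eST; do 3 left.
  case: (diamond_cases ST SS TT X Y SS_ST TT_ST FX FY)
    => [XY|YX|[-> ->]|[-> ->]].
  - by rewrite (setIidl XY) (setUidr XY) T_id //; exact: Fcl.
  - by rewrite (setIidr YX) (setUidl YX) T_id //; exact: Fcl.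
  - by split; first by right.
  - by rewrite setIC setUC; split; first by right.
split=> //; split; first exact: is_partial_order_subset.
by move=> X Y FX FY; have [hi hs] := bounds X Y FX FY; split;
  [exists (X `&` Y) | exists (T (X `|` Y))].
Qed.
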